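(* Let $T,T'\subseteq\mathbb{TP}(X)$ be lower (respectively upper) tropically convex sets. Then $\underline{\mathrm{tconv}}(T\cup T')=\bigcup_{\alpha\in T,\alpha'\in T'}\underline{[\alpha,\alpha']}$ (respectively $\overline{\mathrm{tconv}}(T\cup T')=\bigcup_{\alpha\in T,\alpha'\in T'}\overline{[\alpha,\alpha']}$). If in addition $T$ and $T'$ are compact, then $\underline{\mathrm{tconv}}(T\cup T')$ (respectively $\overline{\mathrm{tconv}}(T\cup T')$) is compact, and each $\beta\in\underline{\mathrm{tconv}}(T\cup T')$ (respectively $\beta\in\overline{\mathrm{tconv}}(T\cup T')$) lies on the tropical segment $\underline{[\underline{\pi}_T(\beta),\underline{\pi}_{T'}(\beta)]}$ (respectively $\overline{[\overline{\pi}_T(\beta),\overline{\pi}_{T'}(\beta)]}$).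
   Context: $X$ is a locally compact Hausdorff space with a Borel measure $\mu$ with $\mu(X)\in(0,\infty)$, such that no nonconstant $f\in BC(X)$ equals a constant $\mu$-a.e. $\mathbb{TP}(X)=BC(X)/\{\text{constants}\}$ with metric $\rho([f],[g])=\sup(f-g)-\inf(f-g)$. For $\alpha=[f],\beta=[g]$, $\underline{[\alpha,\beta]}=\{[\min(a+f,b+g)]:a,b\in\mathbb R\}$ and $\overline{[\alpha,\beta]}=\{[\max(a+f,b+g)]:a,b\in\mathbb R\}$ are the lower and upper tropical segments; a set is lower (resp. upper) tropically convex if it contains the lower (resp. upper) segment between any two of its points, and $\underline{\mathrm{tconv}}(S)$ (resp. $\overline{\mathrm{tconv}}(S)$) is the smallest lower (resp. upper) tropically convex set containing $S$. For compact lower (resp. upper) tropically convex $T$ and $\gamma\in\mathbb{TP}(X)$, $\underline{\pi}_T(\gamma)$ (resp. $\overline{\pi}_T(\gamma)$) is the unique element of $T$ minimizing $\alpha\mapsto\left(\int_X(h-\inf h)^pd\mu\right)^{1/p}$ (resp. $\alpha\mapsto\left(\int_X(\sup h-h)^pd\mu\right)^{1/p}$), $[h]=\alpha-\gamma$, for all $p\in[1,\infty)$.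
   Formalization: The sets T and T' are assumed nonempty: if T is empty and T' is not, the union of segments is empty while the tropical convex hull of the union equals T', and the projection onto T does not exist. *)

(* Defs.v *)
From HB Require Import structures.
From mathcomp Require Import all_boot all_order all_algebra ring_quotient.
From mathcomp Require Import lra.
From mathcomp Require Import all_classical all_reals all_analysis.

Set Implicit Arguments.
Unset Strict Implicit.
Unset Printing Implicit Defensive.

Import Order.TTheory GRing.Theory Num.Theory.
Import numFieldTopology.Exports numFieldNormedType.Exports.

Local Open Scope classical_set_scope.
Local Open Scope ring_scope.
Local Open Scope quotient_scope.

(* The library's measurable types are pointed, hence [ptopologicalType]. *)
Notation borel X := (g_sigma_algebraType (@open X)).

Section BoundedContinuous.
Variables (R : realType) (X : ptopologicalType).

Definition bounded_continuous : {pred X -> R} :=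
  fun f => `[< continuous f /\ bounded_fun f >].

Lemma bounded_continuousP (f : X -> R) :
  f \in bounded_continuous <->
  continuous f /\ exists M, forall x, `|f x| <= M.
Proof.
have PF : ProperFilter (globally [set: X]).
  exact: (@globally_properfilter X setT point).
split=> [/asboolP[cf /ex_bound[M bM]]|[cf [M bM]]].
  by split=> //; exists M => x; exact: bM.
by apply/asboolP; split=> //; apply/ex_bound; exists M => x _; exact: bM.
Qed.

Fact bounded_continuous_zmod_closed : zmod_closed bounded_continuous.
Proof.
split=> [|f g].
  apply/bounded_continuousP; split=> [x|]; first exact: cvg_cst.
  by exists 0 => x; rewrite normr0.
move=> /bounded_continuousP[cf [M bM]] /bounded_continuousP[cg [N bN]].
apply/bounded_continuousP; split=> [x|].
  by apply: cvgB; [exact: cf|exact: cg].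
by exists (M + N) => x; rewrite (le_trans (ler_normB _ _))// lerD.
Qed.

HB.instance Definition _ :=
  GRing.isZmodClosed.Build (X -> R) bounded_continuous
    bounded_continuous_zmod_closed.

Record BC := MkBC {
  BCfun :> X -> R;
  BCfunP : BCfun \in bounded_continuous }.

HB.instance Definition _ := [isSub for BCfun].
HB.instance Definition _ := [Choice of BC by <:].
HB.instance Definition _ := [SubChoice_isSubZmodule of BC by <:].

Lemma BC_cont (f : BC) : continuous f.
Proof. by have /bounded_continuousP[] := BCfunP f. Qed.

Lemma BC_bounded (f : BC) : exists M, forall x, `|f x| <= M.
Proof. by have /bounded_continuousP[] := BCfunP f. Qed.

Lemma BC_ext (f g : BC) : f =1 g -> f = g.
Proof. by move=> fg; apply/val_inj/funext. Qed.

Lemma BC0E (x : X) : (0 : BC) x = 0. Proof. by []. Qed.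
Lemma BCBE (f g : BC) (x : X) : (f - g) x = f x - g x. Proof. by []. Qed.
Lemma BCDE (f g : BC) (x : X) : (f + g) x = f x + g x. Proof. by []. Qed.

Fact cst_bounded_continuous (c : R) : (fun=> c) \in bounded_continuous.
Proof.
apply/bounded_continuousP; split=> [x|]; first exact: cvg_cst.
by exists `|c|.
Qed.
Definition BCcst (c : R) : BC := MkBC (cst_bounded_continuous c).

Fact min_bounded_continuous (f g : BC) :
  (fun x => Num.min (f x) (g x)) \in bounded_continuous.
Proof.
have [M bM] := BC_bounded f; have [N bN] := BC_bounded g.
apply/bounded_continuousP; split=> [x|].
  by apply: continuous_min; exact: BC_cont.
exists (Num.max M N) => x; rewrite le_max.
by rewrite minEle; case: ifP => _; rewrite ?bM ?bN ?orbT.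
Qed.
Definition BCmin (f g : BC) : BC := MkBC (min_bounded_continuous f g).

Fact max_bounded_continuous (f g : BC) :
  (fun x => Num.max (f x) (g x)) \in bounded_continuous.
Proof.
have [M bM] := BC_bounded f; have [N bN] := BC_bounded g.
apply/bounded_continuousP; split=> [x|].
  by apply: continuous_max; exact: BC_cont.
exists (Num.max M N) => x; rewrite le_max.
by rewrite maxEle; case: ifP => _; rewrite ?bM ?bN ?orbT.
Qed.
Definition BCmax (f g : BC) : BC := MkBC (max_bounded_continuous f g).

Lemma BCcstE (c : R) (x : X) : BCcst c x = c. Proof. by []. Qed.

Lemma BCminE (f g : BC) (x : X) : BCmin f g x = Num.min (f x) (g x).
Proof. by []. Qed.

Lemma BCmaxE (f g : BC) (x : X) : BCmax f g x = Num.max (f x) (g x).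
Proof. by []. Qed.

Definition constants : {pred BC} := fun f => `[< exists c, f = BCcst c >].

Fact constants_zmod_closed : zmod_closed constants.
Proof.
split=> [|f g /asboolP[a ->] /asboolP[b ->]]; apply/asboolP.
  by exists 0; exact: BC_ext.
by exists (a - b); exact: BC_ext.
Qed.

HB.instance Definition _ :=
  GRing.isZmodClosed.Build BC constants constants_zmod_closed.

Definition TP : Type := Quotient.quot constants.
HB.instance Definition _ := GRing.Zmodule.on TP.

Definition tclass (f : BC) : TP := \pi_(Quotient.quot constants) f.
Definition trepr (alpha : TP) : BC := repr (alpha : Quotient.quot constants).

Lemma treprK (alpha : TP) : tclass (trepr alpha) = alpha.
Proof. exact: reprK. Qed.

Lemma tclassP (f g : BC) :
  tclass f = tclass g <-> exists c, forall x, f x = c + g x.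
Proof.
split=> [/eqP|[c fg]].
  rewrite /tclass -Quotient.idealrBE => /asboolP[c fgc]; exists c => x.
  by have /(congr1 (fun h : BC => h x)) := fgc; rewrite BCBE /= => <-; rewrite subrK.
apply/eqP; rewrite /tclass -Quotient.idealrBE; apply/asboolP; exists c.
by apply: BC_ext => x; rewrite BCBE fg addrK.
Qed.

Lemma tclassB (f g : BC) : tclass (f - g) = tclass f - tclass g.
Proof. exact: (raddfB \pi_(Quotient.quot constants)). Qed.

Lemma tclass_trepr (f : BC) :
  exists c, forall x, trepr (tclass f) x = c + f x.
Proof. by apply/tclassP; rewrite treprK. Qed.

Definition osc (f : X -> R) : R := sup (range f) - inf (range f).

Let range_n0 (f : X -> R) : range f !=set0.
Proof. by exists (f point), point. Qed.

Lemma BC_has_ubound (f : BC) : has_ubound (range f).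
Proof.
by have [M bM] := BC_bounded f; exists M => _ [x _ <-]; exact/ler_normlW/bM.
Qed.

Lemma BC_has_lbound (f : BC) : has_lbound (range f).
Proof.
have [M bM] := BC_bounded f; exists (- M) => _ [x _ <-].
by have := bM x; rewrite ler_norml => /andP[].
Qed.

Lemma osc_ub (f : BC) (x y : X) : f x - f y <= osc f.
Proof.
apply: lerB; first by apply: ub_le_sup; [exact: BC_has_ubound|exists x].
by apply: ge_inf; [exact: BC_has_lbound|exists y].
Qed.

Lemma osc_le (f : X -> R) (M : R) :
  (forall x y, f x - f y <= M) -> osc f <= M.
Proof.
move=> fM; rewrite /osc lerBlDr; apply: ge_sup => // _ [x _ <-].
rewrite -lerBlDl; apply: lb_le_inf => // _ [y _ <-].
by rewrite lerBlDl -lerBlDr fM.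
Qed.

Lemma inf_shift (f g : BC) (c : R) :
  (forall x, f x = c + g x) -> inf (range f) = c + inf (range g).
Proof.
move=> fg; apply/eqP; rewrite eq_le; apply/andP; split.
  rewrite -lerBlDl; apply: lb_le_inf => // _ [x _ <-]; rewrite lerBlDl -fg.
  by apply: ge_inf; [exact: BC_has_lbound|exists x].
apply: lb_le_inf => // _ [x _ <-]; rewrite fg lerD2l.
by apply: ge_inf; [exact: BC_has_lbound|exists x].
Qed.

Lemma sup_shift (f g : BC) (c : R) :
  (forall x, f x = c + g x) -> sup (range f) = c + sup (range g).
Proof.
move=> fg; apply/eqP; rewrite eq_le; apply/andP; split.
  apply: ge_sup => // _ [x _ <-]; rewrite fg lerD2l.
  by apply: ub_le_sup; [exact: BC_has_ubound|exists x].
rewrite -lerBrDl; apply: ge_sup => // _ [x _ <-]; rewrite lerBrDl -fg.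
by apply: ub_le_sup; [exact: BC_has_ubound|exists x].
Qed.

Lemma osc_shift (f g : BC) (c : R) :
  (forall x, f x = c + g x) -> osc f = osc g.
Proof.
move=> fg; apply/eqP; rewrite eq_le; apply/andP; split; apply: osc_le => x y.
  by have := osc_ub g x y; rewrite !fg; lra.
by have := osc_ub f x y; rewrite !fg; lra.
Qed.

Definition rho (alpha beta : TP) : R := osc (trepr alpha - trepr beta).

Lemma rhoE (f g : BC) : rho (tclass f) (tclass g) = osc (f - g).
Proof.
have [c fc] := tclass_trepr f; have [d gd] := tclass_trepr g.
by apply: (@osc_shift _ _ (c - d)) => x; rewrite !BCBE fc gd; lra.
Qed.

Fact rhoxx (alpha : TP) : rho alpha alpha = 0.
Proof.
apply/eqP; rewrite eq_le; apply/andP; split.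
  by apply: osc_le => x y; rewrite !BCBE !subrr.
by have := osc_ub (trepr alpha - trepr alpha) point point; rewrite subrr.
Qed.

Fact rho_eq0 (alpha beta : TP) : rho alpha beta = 0 -> alpha = beta.
Proof.
move=> rho0; rewrite -[alpha]treprK -[beta]treprK.
apply/tclassP; exists ((trepr alpha - trepr beta) point) => x.
have h y z : (trepr alpha - trepr beta) y <= (trepr alpha - trepr beta) z.
  by rewrite -subr_le0 -rho0 osc_ub.
have -> : (trepr alpha - trepr beta) point = (trepr alpha - trepr beta) x.
  by apply/eqP; rewrite eq_le !h.
by rewrite BCBE subrK.
Qed.

Fact rho_sym (alpha beta : TP) : rho alpha beta = rho beta alpha.
Proof.
have le a b : rho a b <= rho b a.
  apply: osc_le => x y; apply: le_trans (osc_ub (trepr b - trepr a) y x).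
  by rewrite !BCBE; lra.
by apply/eqP; rewrite eq_le !le.
Qed.

Fact rho_triangle (beta alpha gamma : TP) :
  rho alpha gamma <= rho alpha beta + rho beta gamma.
Proof.
apply: osc_le => x y.
have := lerD (osc_ub (trepr alpha - trepr beta) x y)
             (osc_ub (trepr beta - trepr gamma) x y).
by apply: le_trans; rewrite !BCBE; lra.
Qed.

HB.instance Definition _ :=
  isMetric.Build R TP rhoxx rho_eq0 rho_sym rho_triangle.

Lemma mdistE (alpha beta : TP) : mdist alpha beta = rho alpha beta.
Proof. by []. Qed.

Definition lseg (alpha beta : TP) : set TP :=
  [set gamma | exists a b : R, gamma =
    tclass (BCmin (BCcst a + trepr alpha) (BCcst b + trepr beta))].

Definition useg (alpha beta : TP) : set TP :=
  [set gamma | exists a b : R, gamma =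
    tclass (BCmax (BCcst a + trepr alpha) (BCcst b + trepr beta))].

Lemma lsegE (f g : BC) : lseg (tclass f) (tclass g) =
  [set gamma | exists a b : R,
    gamma = tclass (BCmin (BCcst a + f) (BCcst b + g))].
Proof.
have [c fc] := tclass_trepr f; have [d gd] := tclass_trepr g.
apply/seteqP; split=> [_ [a [b ->]]|_ [a [b ->]]].
  exists (a + c), (b + d); congr tclass; apply: BC_ext => x.
  by rewrite !BCminE !BCDE !BCcstE fc gd !addrA.
exists (a - c), (b - d); congr tclass; apply: BC_ext => x.
by rewrite !BCminE !BCDE !BCcstE fc gd !addrA !subrK.
Qed.

Lemma usegE (f g : BC) : useg (tclass f) (tclass g) =
  [set gamma | exists a b : R,
    gamma = tclass (BCmax (BCcst a + f) (BCcst b + g))].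
Proof.
have [c fc] := tclass_trepr f; have [d gd] := tclass_trepr g.
apply/seteqP; split=> [_ [a [b ->]]|_ [a [b ->]]].
  exists (a + c), (b + d); congr tclass; apply: BC_ext => x.
  by rewrite !BCmaxE !BCDE !BCcstE fc gd !addrA.
exists (a - c), (b - d); congr tclass; apply: BC_ext => x.
by rewrite !BCmaxE !BCDE !BCcstE fc gd !addrA !subrK.
Qed.

Definition ltconvex (S : set TP) : Prop :=
  forall alpha beta, S alpha -> S beta -> lseg alpha beta `<=` S.

Definition utconvex (S : set TP) : Prop :=
  forall alpha beta, S alpha -> S beta -> useg alpha beta `<=` S.

Definition ltconv (S : set TP) : set TP := smallest ltconvex S.

Definition utconv (S : set TP) : set TP := smallest utconvex S.

Lemma ltconv_convex (S : set TP) : ltconvex (ltconv S).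
Proof.
move=> alpha beta Sa Sb gamma gab M MS.
by apply: (MS.1 _ _ (Sa _ MS) (Sb _ MS)).
Qed.

Lemma utconv_convex (S : set TP) : utconvex (utconv S).
Proof.
move=> alpha beta Sa Sb gamma gab M MS.
by apply: (MS.1 _ _ (Sa _ MS) (Sb _ MS)).
Qed.

Section Projections.
Variable mu : {measure set (borel X) -> \bar R}.

Definition lnorm (p : R) (h : X -> R) : \bar R :=
  ((\int[mu]_x ((h x - inf (range h)) `^ p)%:E) `^ p^-1)%E.

Definition unorm (p : R) (h : X -> R) : \bar R :=
  ((\int[mu]_x ((sup (range h) - h x) `^ p)%:E) `^ p^-1)%E.

Lemma lnormE (p : R) (h : BC) :
  lnorm p (trepr (tclass h)) = lnorm p h.
Proof.
have [c hc] := tclass_trepr h.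
have e : (fun x => trepr (tclass h) x - inf (range (trepr (tclass h)))) =
         (fun x => h x - inf (range h)).
  by apply/funext => x; rewrite (inf_shift hc) hc; lra.
exact: (congr1 (fun u : X -> R =>
  ((\int[mu]_x (u x `^ p)%:E) `^ p^-1)%E) e).
Qed.

Lemma unormE (p : R) (h : BC) :
  unorm p (trepr (tclass h)) = unorm p h.
Proof.
have [c hc] := tclass_trepr h.
have e : (fun x => sup (range (trepr (tclass h))) - trepr (tclass h) x) =
         (fun x => sup (range h) - h x).
  by apply/funext => x; rewrite (sup_shift hc) hc; lra.
exact: (congr1 (fun u : X -> R =>
  ((\int[mu]_x (u x `^ p)%:E) `^ p^-1)%E) e).
Qed.

Definition is_lproj (T : set TP) (gamma alpha : TP) : Prop :=
  T alpha /\ forall (p : R) (alpha' : TP), 1 <= p -> T alpha' ->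
    (lnorm p (trepr (alpha - gamma)%R) <= lnorm p (trepr (alpha' - gamma)%R))%E.

Definition is_uproj (T : set TP) (gamma alpha : TP) : Prop :=
  T alpha /\ forall (p : R) (alpha' : TP), 1 <= p -> T alpha' ->
    (unorm p (trepr (alpha - gamma)%R) <= unorm p (trepr (alpha' - gamma)%R))%E.

(* The default value 0 is irrelevant: the minimizer exists and is unique when
   T is nonempty, compact and tropically convex. *)
Definition lproj (T : set TP) (gamma : TP) : TP := xget 0 (is_lproj T gamma).

Definition uproj (T : set TP) (gamma : TP) : TP := xget 0 (is_uproj T gamma).

End Projections.

End BoundedContinuous.

(* Main.v *)
(* Writing classes through their lifts in BC(X), the lower segment between two
   classes consists of the classes of min(f, g), f and g ranging over all lifts;
   so the union of the segments between T and T' is lower convex because minima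
   can be regrouped. It is compact as the continuous image of T x T' x [-1, 1].
   For the projections, fix a lift g of gamma. Among the lifts f >= g of elements
   of T there is a pointwise least one: the lifts touching g from above are
   directed downwards under min, and compactness provides a limit. It minimizes
   every p-norm of f - g, and the case p = 1 shows that no other class does.
   If gamma is the class of g = min(f, f') with f, f' lifts of elements of T and
   T', the least lifts k and k' satisfy g <= k <= f and g <= k' <= f', hence
   g = min(k, k'). The upper case follows by applying negation. *)
Require Import Defs.
From mathcomp Require Import all_boot all_order all_algebra.
From mathcomp Require Import lra.
From mathcomp Require Import all_classical all_reals all_analysis.
From mathcomp Require Import measurable_realfun.

Set Implicit Arguments.
Unset Strict Implicit.
Unset Printing Implicit Defensive.

Import Order.TTheory GRing.Theory Num.Theory.
Import numFieldTopology.Exports numFieldNormedType.Exports.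

Local Open Scope classical_set_scope.
Local Open Scope ring_scope.

(** * Lower segments through lifts, and the hull of a union *)

Section LowerSegments.
Context {R : realType} {X : ptopologicalType}.
Implicit Types (f g : BC R X) (alpha beta gamma : TP R X) (S T : set (TP R X)).

Lemma tclass_shift c f : tclass (BCcst X c + f) = tclass f.
Proof. by apply/tclassP; exists c. Qed.

(** Boundedness makes the supremum of [f - g] a valid shift. A lift raised this far no longer
    affects a minimum with [f]. *)
Lemma BC_dominated f g : exists c, forall x, f x <= c + g x.
Proof.
exists (sup (range (f - g))) => x; rewrite -lerBlDr -BCBE.
by apply: ub_le_sup; [exact: BC_has_ubound|exists x].
Qed.

(** The two additive constants are absorbed into the choice of lifts, so later arguments handle
    neither constants nor chosen representatives. *)
Lemma lsegP alpha beta gamma : lseg alpha beta gamma <->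
  exists f g, [/\ tclass f = alpha, tclass g = beta &
    gamma = tclass (BCmin f g)].
Proof.
split=> [[a [b ->]]|[f [g [<- <- ->]]]].
  exists (BCcst X a + trepr alpha), (BCcst X b + trepr beta).
  by rewrite !tclass_shift !treprK.
rewrite lsegE; exists 0, 0; congr tclass; apply: BC_ext => x.
by rewrite !BCminE !BCDE !BCcstE !add0r.
Qed.

Lemma BCminC f g : BCmin f g = BCmin g f.
Proof. by apply: BC_ext => x; rewrite !BCminE minC. Qed.

Lemma BCmin_l f g : (forall x, f x <= g x) -> BCmin f g = f.
Proof. by move=> fg; apply: BC_ext => x; rewrite BCminE min_l. Qed.

Lemma lseg_sym alpha beta : lseg alpha beta `<=` lseg beta alpha.
Proof.
move=> _ /lsegP[f [g [fa gb ->]]]; apply/lsegP; exists g, f.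
by rewrite BCminC.
Qed.

Lemma lseg_l alpha beta : lseg alpha beta alpha.
Proof.
have [c h] := BC_dominated (trepr alpha) (trepr beta).
apply/lsegP; exists (trepr alpha), (BCcst X c + trepr beta).
by rewrite tclass_shift !treprK BCmin_l ?treprK.
Qed.

Lemma ltconvexP S : ltconvex S <->
  forall f g, S (tclass f) -> S (tclass g) -> S (tclass (BCmin f g)).
Proof.
split=> [cS f g Sf Sg|cS alpha beta Sa Sb _ /lsegP[f [g [fa gb ->]]]].
  by apply: (cS _ _ Sf Sg); apply/lsegP; exists f, g.
by apply: cS; rewrite ?fa ?gb.
Qed.

Lemma ltconv_setU T T' : T !=set0 -> T' !=set0 -> ltconvex T -> ltconvex T' ->
  ltconv (T `|` T') =
    \bigcup_(alpha in T) \bigcup_(alpha' in T') lseg alpha alpha'.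
Proof.
move=> [t0 Tt0] [t1 Tt1] cT cT'; apply/seteqP; split.
  apply: smallest_sub => [|alpha [Ta|Ta]]; last 2 first.
  - by exists alpha => //; exists t1 => //; exact: lseg_l.
  - by exists t0 => //; exists alpha => //; exact/lseg_sym/lseg_l.
  apply/ltconvexP => f g [a Ta [a' Ta' /lsegP[f1 [f2 [fa fa' ef]]]]].
  move=> [b Tb [b' Tb' /lsegP[g1 [g2 [gb gb' eg]]]]].
  (* The given lifts [f], [g] agree with the minima only up to constants [c], [d], which are moved
     into the four lifts before regrouping by [minACA]. *)
  have [c hf] := (tclassP _ _).1 ef; have [d hg] := (tclassP _ _).1 eg.
  exists (tclass (BCmin (BCcst X c + f1) (BCcst X d + g1))).
    by apply: ((ltconvexP T).1 cT); rewrite tclass_shift ?fa ?gb.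
  exists (tclass (BCmin (BCcst X c + f2) (BCcst X d + g2))).
    by apply: ((ltconvexP T').1 cT'); rewrite tclass_shift ?fa' ?gb'.
  apply/lsegP; exists (BCmin (BCcst X c + f1) (BCcst X d + g1)).
  exists (BCmin (BCcst X c + f2) (BCcst X d + g2)); split=> //.
  congr tclass; apply: BC_ext => x.
  by rewrite !BCminE hf hg !BCDE !BCminE minACA !BCcstE !addr_minr.
move=> gamma [a Ta [b Tb]]; apply: ltconv_convex => M [_ sM]; apply: sM.
  by left.
by right.
Qed.

End LowerSegments.

(** * Continuous parametrization of segments and compactness of the hull *)

Section Compactness.
Context {R : realType} {X : ptopologicalType}.
Implicit Types (f g : BC R X) (alpha beta gamma : TP R X) (S T : set (TP R X)).

(* Unlike [trepr], this section of [tclass] is continuous. *)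
Definition pinned alpha : BC R X :=
  BCcst X (- trepr alpha point) + trepr alpha.

Lemma pinnedK alpha : tclass (pinned alpha) = alpha.
Proof. by rewrite tclass_shift treprK. Qed.

(** Both pinned lifts vanish at [point], so their difference at [x] is a difference of two values of
    one function, bounded by its oscillation. *)
Lemma pinned_lip alpha beta x :
  `|pinned alpha x - pinned beta x| <= rho alpha beta.
Proof.
rewrite !BCDE !BCcstE.
have := osc_ub (trepr alpha - trepr beta) x point.
have := osc_ub (trepr alpha - trepr beta) point x.
by rewrite /rho !BCBE ler_norml; lra.
Qed.

(** Only the relative shift of the two lifts matters, and beyond plus or minus [rho] it yields an
    endpoint. Scaling by [rho] gives all segments the same parameter interval. *)
Definition lseg_param (z : TP R X * TP R X * R) : TP R X :=
  tclass (BCmin (pinned z.1.1)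
    (BCcst X (z.2 * rho z.1.1 z.1.2) + pinned z.1.2)).

Lemma lsegE_param alpha beta :
  lseg alpha beta = (fun t => lseg_param (alpha, beta, t)) @` `[-1, 1].
Proof.
have ub x := pinned_lip alpha beta x; have r0 := ub point.
have {}r0 : 0 <= rho alpha beta by apply: le_trans r0.
apply/seteqP; split=> [gamma|_ [t _ <-]]; last first.
  apply/lsegP; exists (pinned alpha).
  exists (BCcst X (t * rho alpha beta) + pinned beta).
  by rewrite tclass_shift !pinnedK.
rewrite -[in lseg _ _](pinnedK alpha) -[in lseg _ _](pinnedK beta).
rewrite lsegE => -[a [b ->]].
pose c := b - a; set r := rho alpha beta in r0 ub *.
have -> : tclass (BCmin (BCcst X a + pinned alpha) (BCcst X b + pinned beta)) =
    tclass (BCmin (pinned alpha) (BCcst X c + pinned beta)).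
  apply/tclassP; exists a => x.
  by rewrite !BCminE addr_minr !BCDE !BCcstE /c; congr Num.min; lra.
(* Since the pinned lifts differ by at most [r], a shift of at least [r], or at most [- r], leaves
   one of them as the minimum. *)
have min1 s : r <= s -> BCmin (pinned alpha) (BCcst X s + pinned beta) =
    pinned alpha.
  move=> rs; apply: BCmin_l => x; rewrite BCDE BCcstE.
  by have := ub x; rewrite ler_norml; lra.
have min2 s : s <= - r -> BCmin (pinned alpha) (BCcst X s + pinned beta) =
    BCcst X s + pinned beta.
  move=> rs; rewrite BCminC; apply: BCmin_l => x; rewrite BCDE BCcstE.
  by have := ub x; rewrite ler_norml; lra.
have [rc|cr] := leP r c.
  exists 1; first by rewrite /= in_itv/=; lra.
  by rewrite /lseg_param /= mul1r !min1.
have [cr'|rc] := leP c (- r).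
  exists (-1); first by rewrite /= in_itv/=; lra.
  by rewrite /lseg_param /= mulN1r !min2// !tclass_shift.
(* Here [- r < c < r], so [r] is nonzero and [c / r] is a legitimate parameter. *)
have {}r0 : 0 < r by lra.
exists (c / r).
  by rewrite /= in_itv/= ler_pdivlMr// ler_pdivrMr// mulN1r mul1r !ltW.
by rewrite /lseg_param /= divfK// gt_eqF.
Qed.

(** Perturbing the arguments of a minimum moves it uniformly by at most [e + e']; an oscillation is
    at most twice the uniform norm. *)
Lemma rho_BCmin_le f g f' g' (e e' : R) :
  (forall x, `|f x - f' x| <= e) -> (forall x, `|g x - g' x| <= e') ->
  rho (tclass (BCmin f g)) (tclass (BCmin f' g')) <= 2 * (e + e').
Proof.
move=> fe ge; rewrite rhoE; apply: osc_le => x y.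
have bnd z : `|BCmin f g z - BCmin f' g' z| <= e + e'.
  have := fe z; have := ge z; rewrite !BCminE.
  have : 0 <= `|f z - f' z| by [].
  have : 0 <= `|g z - g' z| by [].
  rewrite !ler_norml.
  by case: (leP (f z)); case: (leP (f' z)); lra.
by have := bnd x; have := bnd y; rewrite !BCBE !ler_norml; lra.
Qed.

Lemma rho_dist alpha beta alpha' beta' :
  `|rho alpha beta - rho alpha' beta'| <= rho alpha alpha' + rho beta beta'.
Proof.
rewrite ler_norml.
have := rho_triangle alpha' alpha beta; have := rho_triangle beta' alpha' beta.
have := rho_triangle alpha alpha' beta'; have := rho_triangle beta alpha beta'.
rewrite (rho_sym alpha' alpha) (rho_sym beta' beta); lra.
Qed.

Lemma rho_continuous : continuous (fun z : TP R X * TP R X => rho z.1 z.2).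
Proof.
move=> z; apply/cvgrPdist_le => e e0.
have e2 : 0 < e / 2 by rewrite divr_gt0.
near=> w; apply: le_trans (rho_dist _ _ _ _) _; rewrite [e]splitr lerD//.
  by rewrite -mdistE; near: w;
    exact: (metricType_numDomainType.cvgr_dist_le cvg_fst).
by rewrite -mdistE; near: w;
    exact: (metricType_numDomainType.cvgr_dist_le cvg_snd).
Unshelve. all: by end_near. Qed.

Lemma lseg_param_continuous : continuous lseg_param.
Proof.
move=> z; apply/metricType_numDomainType.cvgrPdist_le => e e0.
(* The first lift moves by [e / 6], the second by [e / 6] for its shift and [e / 6] for its pinned
   part; [rho_BCmin_le] doubles the total. *)
have e6 : 0 < e / 6 by rewrite divr_gt0.
have c1 : (w.1.1 @[w --> z] --> z.1.1).
  exact: (continuous_comp (f := fst) (g := fst) cvg_fst cvg_fst).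
have c2 : (w.1.2 @[w --> z] --> z.1.2).
  exact: (continuous_comp (f := fst) (g := snd) cvg_fst cvg_snd).
have c3 : (w.2 * rho w.1.1 w.1.2 @[w --> z] --> z.2 * rho z.1.1 z.1.2).
  apply: cvgM; first exact: cvg_snd.
  exact: (continuous_comp (f := fst) cvg_fst (@rho_continuous z.1)).
near=> w.
have h1 : rho z.1.1 w.1.1 <= e / 6.
  by rewrite -mdistE; near: w;
    exact: (metricType_numDomainType.cvgr_dist_le c1).
have h2 : rho z.1.2 w.1.2 <= e / 6.
  by rewrite -mdistE; near: w;
    exact: (metricType_numDomainType.cvgr_dist_le c2).
have h3 : `|z.2 * rho z.1.1 z.1.2 - w.2 * rho w.1.1 w.1.2| <= e / 6.
  by near: w; move/cvgrPdist_le : c3; exact.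
rewrite mdistE.
apply: le_trans (_ : 2 * (e / 6 + (e / 6 + e / 6)) <= _); last lra.
apply: rho_BCmin_le => x; first exact: le_trans (pinned_lip _ _ _) h1.
have := le_trans (pinned_lip z.1.2 w.1.2 x) h2.
by rewrite !BCDE !BCcstE; move: h3; rewrite !ler_norml; lra.
Unshelve. all: by end_near. Qed.

Lemma ltconv_setU_compact T T' : T !=set0 -> T' !=set0 ->
  ltconvex T -> ltconvex T' -> compact T -> compact T' ->
  compact (ltconv (T `|` T')).
Proof.
move=> T0 T0' cvT cvT' cT cT'; rewrite ltconv_setU//.
rewrite (_ : \bigcup_(_ in _) _ = lseg_param @` ((T `*` T') `*` `[-1, 1])).
  apply: continuous_compact.
    exact/continuous_subspaceT/lseg_param_continuous.
  by apply: compact_setX; [exact: compact_setX|exact: segment_compact].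
apply/seteqP; split.
  move=> gamma [a Ta [b Tb]]; rewrite lsegE_param => -[t t1 <-].
  by exists (a, b, t).
move=> _ [[[a b] t] [[/= Ta Tb] t1] <-].
by exists a => //; exists b => //; rewrite lsegE_param; exists t.
Qed.

End Compactness.

(** * Least lifts above a given function *)

Section Domination.
Context {R : realType} {X : ptopologicalType}.
Implicit Types (f g h : BC R X) (alpha beta gamma : TP R X).
Implicit Types S T : set (TP R X).

Lemma BCinf_le h x : inf (range h) <= h x.
Proof. by apply: ge_inf; [exact: BC_has_lbound|exists x]. Qed.

Lemma BCinf_ge h c : (forall x, c <= h x) -> c <= inf (range h).
Proof.
by move=> ch; apply: lb_le_inf => [|_ [x _ <-]//]; exists (h point), point.
Qed.

(** The least lift of [alpha] lying above [g], as [tight_ge] and [tight_le] show. *)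
Definition tight g alpha : BC R X :=
  BCcst X (- inf (range (trepr alpha - g))) + trepr alpha.

Lemma tightE g alpha x :
  tight g alpha x = trepr alpha x - inf (range (trepr alpha - g)).
Proof. by rewrite BCDE BCcstE addrC. Qed.

Lemma tightK g alpha : tclass (tight g alpha) = alpha.
Proof. by rewrite tclass_shift treprK. Qed.

Lemma tight_ge g alpha x : g x <= tight g alpha x.
Proof. by have := BCinf_le (trepr alpha - g) x; rewrite tightE BCBE; lra. Qed.

Lemma tight_le g f : (forall x, g x <= f x) ->
  forall x, tight g (tclass f) x <= f x.
Proof.
move=> gf x; rewrite tightE; have [c hc] := tclass_trepr f.
suff : c <= inf (range (trepr (tclass f) - g)) by rewrite hc; lra.
by apply: BCinf_ge => y; rewrite BCBE hc; have := gf y; lra.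
Qed.

(** The difference of the two representatives varies by at most [rho alpha beta] between points,
    which bounds the change of the normalizing infimum. This lets tight lifts pass to a cluster
    point. *)
Lemma tight_lip g alpha beta x :
  tight g alpha x <= tight g beta x + rho alpha beta.
Proof.
rewrite !tightE.
suff : inf (range (trepr beta - g)) -
    (rho alpha beta - (trepr alpha x - trepr beta x)) <= inf (range (trepr alpha - g)) by lra.
apply: BCinf_ge => y; have := BCinf_le (trepr beta - g) y.
have := osc_ub (trepr alpha - trepr beta) x y.
by rewrite /rho !BCBE; lra.
Qed.

(** A description of the projection that involves neither the measure nor [p]: [f] is least among
    the lifts above [g] of all elements of [T]. *)
Definition least_above T g f := [/\ T (tclass f), (forall x, g x <= f x) &
  forall f', T (tclass f') -> (forall x, g x <= f' x) -> forall x, f x <= f' x].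

Lemma least_above_exists T g : T !=set0 -> ltconvex T -> compact T ->
  exists f, least_above T g f.
Proof.
move=> [t0 Tt0] cvT cT.
pose below alpha :=
  [set beta | T beta /\ forall x, tight g beta x <= tight g alpha x].
(* Lower convexity makes the sets [below alpha] a filter base. *)
have FF : Filter (filter_from T below).
  apply: filter_from_filter; first by exists t0.
  move=> a b Ta Tb; set m := BCmin (tight g a) (tight g b).
  have gm x : g x <= m x by rewrite BCminE le_min !tight_ge.
  (* The minimum of two tight lifts lies above [g], so the tight lift of its class lies below
     both. *)
  exists (tclass m); first by apply: ((ltconvexP T).1 cvT); rewrite tightK.
  move=> c [Tc hc]; split; split=> // x; apply: le_trans (hc x) _.
    by apply: le_trans (tight_le gm x) _; rewrite BCminE ge_min lexx.
  by apply: le_trans (tight_le gm x) _; rewrite BCminE ge_min lexx orbT.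
have PF : ProperFilter (filter_from T below).
  by apply: filter_from_proper => a Ta; exists a; split.
have [|p [Tp clp]] := cT _ PF; first by exists t0 => // a [].
exists (tight g p); split=> [|x|f Tf gf x]; rewrite ?tightK ?tight_ge//.
apply: le_trans (tight_le gf x); apply/ler_addgt0Pr => e e0.
(* Some [q] within [e] of the cluster point [p] has its tight lift below that of [f]; hence
   [tight g p] exceeds the latter by at most [e]. *)
have [] := clp (below (tclass f)) (ball p e) _ (nbhsx_ballx _ _ e0).
  by exists (tclass f).
move=> q [[_ hq]]; rewrite ballEmdist /= mdistE => /ltW pq.
exact: le_trans (tight_lip _ _ _ _) (lerD (hq x) pq).
Qed.

(** The tight lift of the class of [f] is [f] minus this infimum, and minimality of [f] forbids a
    positive infimum. *)
Lemma least_above_inf T g f : least_above T g f -> inf (range (f - g)) = 0.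
Proof.
move=> [Tf gf lf]; apply/eqP; rewrite eq_le; apply/andP; split.
  have := lf _ _ (tight_ge g (tclass f)) point; rewrite tightK => /(_ Tf).
  rewrite tightE; have [c hc] := tclass_trepr f.
  by rewrite (@inf_shift _ _ _ (f - g) c) ?hc => [|x]; rewrite ?BCBE ?hc; lra.
by apply: BCinf_ge => x; rewrite BCBE subr_ge0.
Qed.

Lemma tight_inf g alpha : inf (range (tight g alpha - g)) = 0.
Proof.
apply: (@least_above_inf [set alpha]); split; first exact: tightK.
  exact: tight_ge.
by move=> f <- gf x; exact: tight_le.
Qed.

End Domination.

(** * Projections as classes of least lifts *)

Section Projection.
Context {R : realType} {X : ptopologicalType}.
Context (mu : {measure set (borel X) -> \bar R}).
Context (mu_fin : (mu [set: borel X] < +oo)%E).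
Context (mu_const : forall (f : BC R X) (c : R),
  {ae mu, forall x : borel X, f x = c} ->
  exists c' : R, forall x : X, f x = c').
Implicit Types (f g h : BC R X) (alpha beta gamma : TP R X).
Implicit Types S T : set (TP R X).

Lemma BC_measurable h : measurable_fun [set: borel X] (h : borel X -> R).
Proof.
apply: (measurability _ (RGenOpens.measurableE R)) => _ [_ [a [b ->] <-]].
rewrite setTI; apply: sub_sigma_algebra.
by have /continuousP := @BC_cont _ _ h; apply; exact: interval_open.
Qed.

Lemma BC_measurable_EFin h :
  measurable_fun [set: borel X] (fun x : borel X => (h x)%:E).
Proof. by apply/measurable_EFinP; exact: BC_measurable. Qed.

Lemma lnorm_powE (p : R) h : inf (range h) = 0 ->
  lnorm mu p h = ((\int[mu]_x (h x `^ p)%:E) `^ p^-1)%E.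
Proof.
move=> h0; rewrite /lnorm h0; congr ((integral _ _ _) `^ _)%E.
by apply/funext => x; rewrite subr0.
Qed.

(** With both infima zero, the norms are ordinary p-norms of nonnegative functions, hence
    monotone. *)
Lemma lnorm_le (p : R) h h' : 1 <= p ->
  inf (range h) = 0 -> inf (range h') = 0 -> (forall x, h x <= h' x) ->
  (lnorm mu p h <= lnorm mu p h')%E.
Proof.
move=> p1 h0 h'0 hh'; have p0 : 0 < p by lra.
have hge x : 0 <= h x by rewrite -h0 BCinf_le.
rewrite !lnorm_powE//.
have mpow k : measurable_fun [set: borel X]
    (fun x : borel X => (BCfun k x `^ p)%:E).
  apply/measurable_EFinP; apply: (measurableT_comp (measurable_powR p)).
  exact: BC_measurable.
apply: gt0_ler_poweR; rewrite ?in_itv/= ?leey ?andbT ?invr_ge0 ?(ltW p0)//.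
- by apply: integral_ge0 => x _; rewrite lee_fin powR_ge0.
- by apply: integral_ge0 => x _; rewrite lee_fin powR_ge0.
apply: ge0_le_integral => // x _; rewrite lee_fin; first exact: powR_ge0.
apply: ge0_ler_powR; rewrite ?nnegrE ?(ltW p0)//.
exact: le_trans (hge x) (hh' x).
Qed.

Lemma lnorm1E h : inf (range h) = 0 -> lnorm mu 1 h = (\int[mu]_x (h x)%:E)%E.
Proof.
move=> h0; have hge x : 0 <= h x by rewrite -h0 BCinf_le.
rewrite lnorm_powE// invr1 poweRe1; last first.
  by apply: integral_ge0 => x _; rewrite lee_fin powR_ge0.
by apply: eq_integral => x _; rewrite powRr1.
Qed.

Lemma lnorm_class (p : R) f g :
  lnorm mu p (trepr (tclass f - tclass g)) = lnorm mu p (f - g).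
Proof. by rewrite -tclassB lnormE. Qed.

(** Each competitor is represented by its tight lift, which lies pointwise above [f]; monotonicity
    then settles all [p] at once. *)
Lemma least_above_lproj T g f : least_above T g f ->
  is_lproj mu T (tclass g) (tclass f).
Proof.
move=> lf; have [Tf gf fmin] := lf.
split; first exact: Tf.
move=> p alpha p1 Ta.
rewrite -[alpha](tightK g) (lnorm_class p f g).
rewrite (lnorm_class p (tight g alpha) g).
apply: lnorm_le p1 (least_above_inf lf) (tight_inf _ _) _ => x.
by rewrite !BCBE lerD2r; apply: fmin; [rewrite tightK|exact: tight_ge].
Qed.

Lemma integral_BC_fin h : (\int[mu]_x (h x)%:E \is a fin_num)%E.
Proof.
apply: integrable_fin_num => //.
apply: measurable_bounded_integrable => //; first exact: BC_measurable.
have PF : ProperFilter (globally [set: borel X]).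
  exact: (@globally_properfilter _ setT point).
by have [M bM] := BC_bounded h; apply/ex_bound; exists M => x _; exact: bM.
Qed.

Lemma integral_BCD h h' : (forall x, 0 <= h x) -> (forall x, 0 <= h' x) ->
  (\int[mu]_x ((h + h') x)%:E = \int[mu]_x (h x)%:E + \int[mu]_x (h' x)%:E)%E.
Proof.
move=> h0 h'0; rewrite -ge0_integralD//.
- by move=> x _; rewrite lee_fin.
- exact: BC_measurable_EFin.
- by move=> x _; rewrite lee_fin.
- exact: BC_measurable_EFin.
Qed.

Lemma integral_BC_eq0 h : (forall x, 0 <= h x) ->
  (\int[mu]_x (h x)%:E = 0)%E -> {ae mu, forall x : borel X, h x = 0}.
Proof.
move=> h0 Ih.
have /(ae_eq_integral_abs mu measurableT (BC_measurable_EFin h)) :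
    (\int[mu]_x `|(h x)%:E| = 0)%E.
  by rewrite -Ih; apply: eq_integral => x _; rewrite gee0_abs ?lee_fin.
by apply: filterS => x /(_ I) [].
Qed.

Lemma is_lproj_unique T g f alpha : least_above T g f ->
  is_lproj mu T (tclass g) alpha -> alpha = tclass f.
Proof.
move=> lf [Ta amin]; have [Tf gf fmin] := lf.
pose f' := tight g alpha; have f'E : tclass f' = alpha := tightK _ _.
have ff' x : f x <= f' x by apply: fmin; [rewrite f'E|exact: tight_ge].
have h0 : inf (range (f - g)) = 0 := least_above_inf lf.
have h'0 : inf (range (f' - g)) = 0 := tight_inf _ _.
have d0 x : 0 <= (f' - f) x by rewrite BCBE subr_ge0.
have := amin 1 _ (lexx _) Tf; rewrite -{1}f'E.
rewrite (lnorm_class 1 f' g) (lnorm_class 1 f g).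
rewrite (lnorm1E h0) (lnorm1E h'0).
(* Splitting off the nonnegative part [f' - f] lets the finite integral of [f - g] cancel, so
   [f' - f] has integral zero. *)
have -> : f' - g = (f' - f) + (f - g) by rewrite addrA subrK.
rewrite integral_BCD// => [|x]; last by rewrite BCBE subr_ge0.
rewrite -leeBrDr ?integral_BC_fin// subee ?integral_BC_fin// => I0.
have {}I0 : (\int[mu]_x ((f' - f) x)%:E = 0)%E.
  apply/eqP; rewrite eq_le I0; apply: integral_ge0 => x _.
  by rewrite lee_fin.
(* Vanishing almost everywhere becomes constancy, which is equality of classes. *)
have [c hc] := mu_const (integral_BC_eq0 d0 I0).
by rewrite -f'E; apply/tclassP; exists c => x; rewrite -(hc x) BCBE subrK.
Qed.

Lemma least_above_lprojE T g f : least_above T g f ->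
  lproj mu T (tclass g) = tclass f.
Proof.
move=> lf; apply: (is_lproj_unique lf).
exact: xgetPex (ex_intro _ _ (least_above_lproj lf)).
Qed.

(** Existence keeps [xget] from returning its default, and uniqueness identifies its choice. *)
Lemma lprojP T gamma alpha : T !=set0 -> ltconvex T -> compact T ->
  is_lproj mu T gamma alpha <-> alpha = lproj mu T gamma.
Proof.
move=> T0 cvT cT; rewrite -(treprK gamma).
have [f lf] := least_above_exists (trepr gamma) T0 cvT cT.
rewrite (least_above_lprojE lf); split=> [|->].
  exact: is_lproj_unique lf.
exact: least_above_lproj.
Qed.

Lemma lseg_lproj T T' beta : T !=set0 -> T' !=set0 ->
  ltconvex T -> ltconvex T' -> compact T -> compact T' ->
  ltconv (T `|` T') beta ->
  lseg (lproj mu T beta) (lproj mu T' beta) beta.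
Proof.
move=> T0 T0' cvT cvT' cT cT'; rewrite ltconv_setU//.
move=> [a Ta [a' Ta' /lsegP[f [f' [fa fa' ->]]]]].
set g := BCmin f f'.
have [k lk] := least_above_exists g T0 cvT cT.
have [k' lk'] := least_above_exists g T0' cvT' cT'.
rewrite (least_above_lprojE lk) (least_above_lprojE lk').
have [_ gk /(_ f) kf] := lk; have [_ gk' /(_ f') kf'] := lk'.
apply/lsegP; exists k, k'; split=> //; congr tclass; apply: BC_ext => x.
have gf y : g y <= f y by rewrite BCminE ge_min lexx.
have gf' y : g y <= f' y by rewrite BCminE ge_min lexx orbT.
(* One inequality uses [g <= k] and [g <= k'], the other [k <= f] and [k' <= f']. *)
apply/eqP; rewrite eq_le; apply/andP; split.
  by rewrite (BCminE k) le_min gk gk'.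
by rewrite !BCminE le_min !ge_min kf ?fa// kf' ?fa'// orbT.
Qed.

End Projection.

(** * Negation exchanges the lower and upper theories *)

Section Duality.
Context {R : realType} {X : ptopologicalType}.
Implicit Types (f g h : BC R X) (alpha beta gamma : TP R X).
Implicit Types S T : set (TP R X).

(** The preimage form commutes with unions by computation; the image form [tnegE] serves for
    compactness. *)
Definition tneg S : set (TP R X) := [set alpha | S (- alpha)].

Lemma tnegE S : tneg S = -%R @` S.
Proof.
apply/seteqP; split=> [alpha Sa|_ [alpha Sa <-]].
  by exists (- alpha); rewrite ?opprK.
by rewrite /tneg /= opprK.
Qed.

Lemma tneg_setU S T : tneg (S `|` T) = tneg S `|` tneg T.
Proof. by []. Qed.

Lemma tneg_nonempty S : S !=set0 -> tneg S !=set0.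
Proof. by move=> [a Sa]; exists (- a); rewrite /tneg /= opprK. Qed.

Lemma tclassN f : tclass (- f) = - tclass f.
Proof.
by rewrite -[- f]add0r tclassB -[RHS]add0r -[0 in LHS](subrr 0) tclassB subrr.
Qed.

Lemma BCNE f x : (- f) x = - f x.
Proof. by []. Qed.

Lemma BCmaxN f g : BCmax f g = - BCmin (- f) (- g).
Proof.
by apply: BC_ext => x; rewrite BCmaxE BCNE BCminE !BCNE -oppr_max opprK.
Qed.

Lemma useg_lseg alpha beta gamma :
  useg alpha beta gamma <-> lseg (- alpha) (- beta) (- gamma).
Proof.
rewrite -(treprK alpha) -(treprK beta) -!tclassN usegE lsegE.
have E a b : tclass (BCmax (BCcst X a + trepr alpha) (BCcst X b + trepr beta)) =
    - tclass (BCmin (BCcst X (- a) + - trepr alpha)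
                    (BCcst X (- b) + - trepr beta)).
  rewrite -tclassN; congr tclass; rewrite BCmaxN; congr (- BCmin _ _);
  by apply: BC_ext => x; rewrite !(BCNE, BCDE) !BCcstE opprD.
split=> -[a [b eg]]; exists (- a), (- b).
  by rewrite eg E opprK.
by rewrite E !opprK -eg opprK.
Qed.

Lemma utconvex_tneg S : utconvex S <-> ltconvex (tneg S).
Proof.
split=> cS alpha beta Sa Sb gamma.
  move=> h; apply: (cS _ _ Sa Sb); apply/useg_lseg.
  by rewrite !opprK.
move=> /useg_lseg h; rewrite -[gamma]opprK.
by apply: (cS (- alpha) (- beta)) h; rewrite /tneg /= opprK.
Qed.

Lemma tnegK S : tneg (tneg S) = S.
Proof. by apply/funext => alpha; rewrite /tneg /= opprK. Qed.

(** Negation matches the upper convex sets containing [S] with the lower convex sets containing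
    [tneg S]. *)
Lemma utconvE S : utconv S = tneg (ltconv (tneg S)).
Proof.
apply/seteqP; split=> [|alpha Sa M [cM sM]].
  apply: smallest_sub => [|alpha Sa M [_ sM]].
    by apply/utconvex_tneg; rewrite tnegK; exact: ltconv_convex.
  by apply: sM; rewrite /tneg /= opprK.
rewrite -[alpha]opprK; apply: (Sa (tneg M)); split; first exact/utconvex_tneg.
by move=> beta; exact: sM.
Qed.

Lemma rhoN alpha beta : rho (- alpha) (- beta) = rho alpha beta.
Proof.
rewrite rho_sym -(treprK alpha) -(treprK beta) -!tclassN !rhoE.
by rewrite opprK addrC.
Qed.

Lemma oppr_TP_continuous : continuous (-%R : TP R X -> TP R X).
Proof.
move=> alpha; have FF := nbhs_filter alpha.
apply/metricType_numDomainType.cvgrPdist_le => e e0.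
near=> beta; rewrite mdistE rhoN -mdistE.
by near: beta; exact: (metricType_numDomainType.cvgr_dist_le cvg_id).
Unshelve. all: by end_near. Qed.

Lemma tneg_compact S : compact S -> compact (tneg S).
Proof.
move=> cS; rewrite tnegE; apply: continuous_compact cS.
exact/continuous_subspaceT/oppr_TP_continuous.
Qed.

Context (mu : {measure set (borel X) -> \bar R}).

Lemma BCsupN h : sup (range h) = - inf (range (- h)).
Proof.
rewrite /inf opprK; congr sup; apply/seteqP.
split=> [_ [x _ <-]|_ [_ [x _ <-] <-]].
  by exists (- h x); [exists x|rewrite opprK].
by exists x; rewrite // opprK.
Qed.

Lemma unormN (p : R) h : unorm mu p h = lnorm mu p (- h).
Proof.
rewrite /unorm /lnorm; congr ((integral _ _ _) `^ _)%E.
by apply/funext => x; rewrite BCsupN addrC.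
Qed.

Lemma unorm_dual (p : R) alpha beta :
  unorm mu p (trepr (alpha - beta)) = lnorm mu p (trepr (- alpha - - beta)).
Proof.
by rewrite unormN -lnormE tclassN treprK opprB opprK addrC.
Qed.

Lemma is_uproj_dual T gamma alpha :
  is_uproj mu T gamma alpha <-> is_lproj mu (tneg T) (- gamma) (- alpha).
Proof.
split=> -[Ta amin]; split.
- by rewrite /tneg /= opprK.
- move=> p beta p1 Tb; rewrite -unorm_dual -[beta]opprK -unorm_dual.
  exact: amin.
- by rewrite -[alpha]opprK.
move=> p beta p1 Tb; rewrite !unorm_dual; apply: amin => //.
by rewrite /tneg /= opprK.
Qed.

Context (mu_fin : (mu [set: borel X] < +oo)%E).
Context (mu_const : forall (f : BC R X) (c : R),
  {ae mu, forall x : borel X, f x = c} ->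
  exists c' : R, forall x : X, f x = c').

(** Both projections are choices, so dual minimality alone does not identify them: the negated upper
    choice is a lower minimizer, and uniqueness does the rest. *)
Lemma uproj_dual T gamma : T !=set0 -> utconvex T -> compact T ->
  uproj mu T gamma = - lproj mu (tneg T) (- gamma).
Proof.
move=> /tneg_nonempty T0 /utconvex_tneg cvT /tneg_compact cT.
have P := lprojP mu_fin mu_const (- gamma) _ T0 cvT cT.
apply: oppr_inj; rewrite opprK; apply/P/is_uproj_dual.
apply: (@xgetPex _ 0 (is_uproj mu T gamma)).
exists (- lproj mu (tneg T) (- gamma)).
by apply/is_uproj_dual; rewrite opprK; apply/P.
Qed.

End Duality.

Theorem theorem6p1 (R : realType) (X : ptopologicalType)
  (mu : {measure set (borel X) -> \bar R})
  (X_lcompact : locally_compact [set: X])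
  (X_hausdorff : hausdorff_space X)
  (mu_gt0 : (0 < mu [set: borel X])%E)
  (mu_fin : (mu [set: borel X] < +oo)%E)
  (mu_const : forall (f : BC R X) (c : R),
    {ae mu, forall x : borel X, f x = c} -> exists c' : R, forall x : X, f x = c') :
  (forall T T' : set (TP R X),
    T !=set0 -> T' !=set0 -> ltconvex T -> ltconvex T' ->
    ltconv (T `|` T') =
      \bigcup_(alpha in T) \bigcup_(alpha' in T') lseg alpha alpha' /\
    (compact T -> compact T' ->
      compact (ltconv (T `|` T')) /\
      forall beta, ltconv (T `|` T') beta ->
        lseg (lproj mu T beta) (lproj mu T' beta) beta)) /\
  (forall T T' : set (TP R X),
    T !=set0 -> T' !=set0 -> utconvex T -> utconvex T' ->
    utconv (T `|` T') =
      \bigcup_(alpha in T) \bigcup_(alpha' in T') useg alpha alpha' /\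
    (compact T -> compact T' ->
      compact (utconv (T `|` T')) /\
      forall beta, utconv (T `|` T') beta ->
        useg (uproj mu T beta) (uproj mu T' beta) beta)).
Proof.
have lower := @ltconv_setU R X; have lowerK := @ltconv_setU_compact R X.
have lowerP := lseg_lproj mu_fin mu_const.
split=> T T' T0 T0' cvT cvT'.
  split; first exact: lower.
  by move=> cT cT'; split=> [|beta]; [exact: lowerK|exact: lowerP].
(* The upper half is the lower half applied to [tneg T] and [tneg T'], then negated back. *)
have N0 := tneg_nonempty T0; have N0' := tneg_nonempty T0'.
have cvN := (utconvex_tneg T).1 cvT; have cvN' := (utconvex_tneg T').1 cvT'.
rewrite utconvE tneg_setU; split.
  rewrite lower//; apply/seteqP.
  split=> [gamma [a Ta [a' Ta' h]]|gamma [a Ta [a' Ta' h]]].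
    exists (- a) => //; exists (- a') => //; apply/useg_lseg.
    by rewrite !opprK.
  exists (- a); first by rewrite /tneg /= opprK.
  by exists (- a'); [rewrite /tneg /= opprK|exact/useg_lseg].
move=> cT cT'; have cN := tneg_compact cT; have cN' := tneg_compact cT'.
split=> [|beta Nb]; first exact/tneg_compact/lowerK.
apply/useg_lseg; rewrite !(uproj_dual mu_fin mu_const)// !opprK.
exact: lowerP.
Qed.
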